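(* Consider the inexact Uzawa algorithm with variable relaxation described in the context, applied to the generalized saddle-point system $Ax+By=f$, $B^tx-Dy=g$. Let $c_1$ be a parameter satisfying $c_1\,R^tQ_i^{-1}R\ \ge\ \Sigma_0^tU^tQ_i^{-1}U\Sigma_0$. If the damping parameter $\theta_i$ satisfies $$\theta_i(1+\beta)\,\delta_2<\frac{2(1-\alpha)}{1-\alpha+2c_1\alpha},$$ then $\rho=\|F_i\|<1$, where $$F_i=\begin{pmatrix}\alpha\,(I+\Sigma_0^tU^tQ_i^{-1}U\Sigma_0) & \sqrt{\alpha}\,\Sigma_0^tU^tQ_i^{-1}R\\ \sqrt{\alpha}\,R^tQ_i^{-1}U\Sigma_0 & -(I-R^tQ_i^{-1}R)\end{pmatrix},$$ so the algorithm converges.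
   Context: Problem. $A\in\mathbb{R}^{n\times n}$ is symmetric positive definite, $B\in\mathbb{R}^{n\times m}$, $D\in\mathbb{R}^{m\times m}$ is symmetric positive semidefinite, and $S=B^tA^{-1}B+D$ is positive definite, so the system $Ax+By=f$, $B^tx-Dy=g$ is uniquely solvable. $\hat A\in\mathbb{R}^{n\times n}$ and $\hat S\in\mathbb{R}^{m\times m}$ are symmetric positive definite (preconditioners for $A$ and $S$), and $H=B^t\hat A^{-1}B+D$. For symmetric matrices, $C_1\le C_2$ means $\langle C_1\phi,\phi\rangle\le\langle C_2\phi,\phi\rangle$ for all $\phi$. $|\cdot|$ is the Euclidean norm and $\|\cdot\|$ the spectral norm. Algorithm. From $(x_i,y_i)$: $f_i=f-(Ax_i+By_i)$, $r_i=\hat A^{-1}f_i$, $\omega_i=\langle f_i,r_i\rangle/\langle Ar_i,r_i\rangle$, $x_{i+1}=x_i+\omega_ir_i$; $g_i=B^tx_{i+1}-Dy_i-g$, $s_i=\hat S^{-1}g_i$, $\hat\tau_i=\langle g_i,s_i\rangle/\langle Hs_i,s_i\rangle$, $\tau_i=\theta_i\hat\tau_i$, $y_{i+1}=y_i+\tau_is_i$, where $\theta_i>0$ is a damping parameter. Constants. $\kappa_1=\mathrm{cond}(\hat A^{-1}A)$ and $\kappa_2=\mathrm{cond}(\hat S^{-1}H)$ (ratios of largest to smallest eigenvalue), $\alpha=\frac{\kappa_1-1}{\kappa_1+1}$, $\beta=\frac{\kappa_2-1}{\kappa_2+1}$. $0<\lambda\le1\le\lambda_0$ are constants with $\lambda\hat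 A\le A\le\lambda_0\hat A$. $c_0$ is the largest eigenvalue of $D^{-1}B^t\hat A^{-1}B$, with $c_0=\infty$ if $D=0$; $\delta_1=\frac{\lambda_0+c_0}{\lambda_0(1+c_0)}$, $\delta_2=\frac{\lambda+c_0}{\lambda(1+c_0)}$ (read as $1/\lambda_0$ and $1/\lambda$ if $c_0=\infty$). Further $\beta_i=|(I-\hat\tau_iH^{1/2}\hat S^{-1}H^{1/2})H^{-1/2}g_i|\,/\,|H^{-1/2}g_i|$, which satisfies $0\le\beta_i\le\beta$. Matrices. $G_i$ is a symmetric positive definite $m\times m$ matrix such that $G_i^{-1}g_i=\hat\tau_i\hat S^{-1}g_i$ and all eigenvalues of $S^{1/2}G_i^{-1}S^{1/2}$ lie in $[(1-\beta_i)\delta_1,(1+\beta_i)\delta_2]$ (the paper shows such a matrix exists). $Q_i$ is defined by $Q_i^{-1}=\theta_iG_i^{-1}$. $B^tA^{-1/2}=U\Sigma V^t$ is a singular value decomposition with $U\in\mathbb{R}^{m\times m}$, $V\in\mathbb{R}^{n\times n}$ orthogonal, $\Sigma=[\Sigma_0,\,0]$, $\Sigma_0\in\mathbb{R}^{m\times m}$ diagonal with the singular values on its diagonal. $R\in\mathbb{R}^{m\times m}$ is nonsingular with $S=RR^t$.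
   Formalization: Convergence is stated for one ρ < 1 bounding ‖F_i‖ at all steps (proved to exist if θ_i is bounded below by a positive constant and θ_i(1+β)δ₂ stays uniformly below the bound); it fails for summable θ_i. For singular nonzero D, c₀ is read as ∞. *)

(* Defs.v *)
From HB Require Import structures.
From mathcomp Require Import all_boot all_order all_algebra.
From mathcomp Require Import all_classical all_reals all_analysis.
Set Implicit Arguments.
Unset Strict Implicit.
Unset Printing Implicit Defensive.
Import Order.TTheory GRing.Theory Num.Theory.
Import numFieldNormedType.Exports.
Local Open Scope classical_set_scope.
Local Open Scope ring_scope.

(* The norm `|_| that MathComp-Analysis puts on matrices is the max norm, hence
   the separate Euclidean and spectral norms below. *)
Definition dotv (R : realType) (n : nat) (u v : 'cV[R]_n) : R :=
  \sum_(j < n) u j ord0 * v j ord0.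

Definition enorm (R : realType) (n : nat) (v : 'cV[R]_n) : R :=
  Num.sqrt (dotv v v).

Definition spectral_norm (R : realType) (n : nat) (M : 'M[R]_n) : R :=
  sup [set enorm (M *m v) | v in [set v : 'cV[R]_n | enorm v <= 1]].

Definition symmetric_mx (R : realType) (n : nat) (M : 'M[R]_n) : Prop :=
  M^T = M.

Definition spd (R : realType) (n : nat) (M : 'M[R]_n) : Prop :=
  symmetric_mx M /\ forall v : 'cV[R]_n, v != 0 -> 0 < dotv (M *m v) v.

Definition spsd (R : realType) (n : nat) (M : 'M[R]_n) : Prop :=
  symmetric_mx M /\ forall v : 'cV[R]_n, 0 <= dotv (M *m v) v.

Definition loewner_le (R : realType) (n : nat) (M1 M2 : 'M[R]_n) : Prop :=
  forall v : 'cV[R]_n, dotv (M1 *m v) v <= dotv (M2 *m v) v.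

Definition orthogonal_mx (R : realType) (n : nat) (M : 'M[R]_n) : Prop :=
  M^T *m M = 1%:M.

(* The unique positive semidefinite square root of a positive semidefinite M. *)
Definition sqrtmx (R : realType) (n : nat) (M : 'M[R]_n) : 'M[R]_n :=
  xget 0 [set P : 'M[R]_n | spsd P /\ P *m P = M].

(* These are only used for matrices similar to symmetric ones, whose spectrum is
   real; for n > 0 it is finite and nonempty, so sup and inf are attained. *)
Definition max_eigenvalue (R : realType) (n : nat) (M : 'M[R]_n) : R :=
  sup [set a | eigenvalue M a].

Definition min_eigenvalue (R : realType) (n : nat) (M : 'M[R]_n) : R :=
  inf [set a | eigenvalue M a].

Definition spectral_cond (R : realType) (n : nat) (M : 'M[R]_n) : R :=
  max_eigenvalue M / min_eigenvalue M.

(* kappa |-> (kappa - 1) / (kappa + 1), giving alpha and beta. *)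
Definition cond_rate (R : realType) (kappa : R) : R := (kappa - 1) / (kappa + 1).

Definition schur (R : realType) (n m : nat)
    (A : 'M[R]_n) (B : 'M[R]_(n, m)) (D : 'M[R]_m) : 'M[R]_m :=
  B^T *m invmx A *m B + D.

(* Largest generalized eigenvalue c of  B^t Ahat^-1 B v = c D v.  When D is
   singular (in particular D = 0) and the Schur complement is positive definite,
   B^t Ahat^-1 B is definite on ker D, so that c is infinite. *)
Definition gen_max_eigenvalue (R : realType) (n m : nat)
    (Ahat : 'M[R]_n) (B : 'M[R]_(n, m)) (D : 'M[R]_m) : \bar R :=
  if D \in unitmx
  then (max_eigenvalue (invmx D *m (B^T *m invmx Ahat *m B)))%:E
  else +oo%E.

(* delta_1 and delta_2 are the values at lambda_0 and lambda. *)
Definition delta (R : realType) (lam : R) (c : \bar R) : R :=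
  match c with
  | EFin r => (lam + r) / (lam * (1 + r))
  | _ => lam^-1
  end.

(* As x / 0 = 0, omega_step and tau_hat are 0 when the residual vanishes; their
   value is then irrelevant since they multiply the zero direction. *)
Definition res_x (R : realType) (n m : nat) (A : 'M[R]_n) (B : 'M[R]_(n, m))
    (f : 'cV[R]_n) (x : 'cV[R]_n) (y : 'cV[R]_m) : 'cV[R]_n :=
  f - (A *m x + B *m y).

Definition omega_step (R : realType) (n : nat) (A Ahat : 'M[R]_n)
    (fi : 'cV[R]_n) : R :=
  let r := invmx Ahat *m fi in dotv fi r / dotv (A *m r) r.

Definition res_y (R : realType) (n m : nat) (B : 'M[R]_(n, m)) (D : 'M[R]_m)
    (g : 'cV[R]_m) (x : 'cV[R]_n) (y : 'cV[R]_m) : 'cV[R]_m :=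
  B^T *m x - D *m y - g.

Definition tau_hat (R : realType) (m : nat) (H Shat : 'M[R]_m)
    (gi : 'cV[R]_m) : R :=
  let s := invmx Shat *m gi in dotv gi s / dotv (H *m s) s.

Definition uzawa_iterates (R : realType) (n m : nat)
    (A : 'M[R]_n) (B : 'M[R]_(n, m)) (D : 'M[R]_m)
    (Ahat : 'M[R]_n) (Shat : 'M[R]_m) (f : 'cV[R]_n) (g : 'cV[R]_m)
    (theta : nat -> R) (x : nat -> 'cV[R]_n) (y : nat -> 'cV[R]_m) : Prop :=
  forall i : nat,
    let fi := res_x A B f (x i) (y i) in
    let gi := res_y B D g (x i.+1) (y i) in
    x i.+1 = x i + omega_step A Ahat fi *: (invmx Ahat *m fi) /\
    y i.+1 = y i +
      (theta i * tau_hat (schur Ahat B D) Shat gi) *: (invmx Shat *m gi).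

Definition beta_step (R : realType) (m : nat) (H Shat : 'M[R]_m)
    (gi : 'cV[R]_m) : R :=
  let h := sqrtmx H in
  let v := invmx h *m gi in
  enorm ((1%:M - tau_hat H Shat gi *: (h *m invmx Shat *m h)) *m v) / enorm v.

Definition local_precond (R : realType) (m : nat) (S H Shat : 'M[R]_m)
    (d1 d2 : R) (gi : 'cV[R]_m) (G : 'M[R]_m) : Prop :=
  [/\ spd G,
      invmx G *m gi = tau_hat H Shat gi *: (invmx Shat *m gi)
    & forall a : R, eigenvalue (sqrtmx S *m invmx G *m sqrtmx S) a ->
        (1 - beta_step H Shat gi) * d1 <= a <= (1 + beta_step H Shat gi) * d2].

Definition damped_mx (R : realType) (m : nat) (theta : R) (G : 'M[R]_m)
  : 'M[R]_m := invmx (theta *: invmx G).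

(* T stands for the factor R of S = R R^t. *)
Definition iter_mx (R : realType) (m : nat) (alpha : R)
    (Sigma0 U T Q : 'M[R]_m) : 'M[R]_(m + m) :=
  block_mx
    (alpha *: (1%:M + Sigma0^T *m U^T *m invmx Q *m U *m Sigma0))
    (Num.sqrt alpha *: (Sigma0^T *m U^T *m invmx Q *m T))
    (Num.sqrt alpha *: (T^T *m invmx Q *m U *m Sigma0))
    (- (1%:M - T^T *m invmx Q *m T)).

(* Main.v *)
Require Import Defs.
From mathcomp Require Import all_boot all_order all_algebra.
From mathcomp Require Import all_classical all_reals all_analysis.
From mathcomp Require Import ring lra.
Import Order.TTheory GRing.Theory Num.Theory.
Import numFieldNormedType.Exports.
Local Open Scope classical_set_scope.
Local Open Scope ring_scope.

(** Put P = Q_i^-1 and W = [sqrt alpha U Sigma0, T]. Then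
    F = diag(alpha, -1) + W^t P W, and the spectral hypothesis on G_i reads
    mu <= T^t P T <= theta_i (1 + beta) delta2 with some mu > 0. Hence F > -1, and
    a weighted Cauchy-Schwarz inequality for P together with
    Sigma0 U^t P U Sigma0 <= c1 T^t P T gives F < 1 under the stated bound;
    all constants depend only on alpha, c1, mu and the bound on theta_i. As F is
    symmetric, bounds on its quadratic form bound its norm.
    For the convergence, let z = V^t A^(-1/2) f_i and eta = T^t (y - y_i). The step
    in x is a steepest descent step, which contracts z by alpha; up to the scaling
    diag(sqrt alpha, 1), the rest of the iteration is then F, so that
    alpha |z|^2 + |eta|^2 decreases geometrically. The weight degenerates for
    alpha = 0, and z is recovered from a uniform bound on a single step. *)

(** * Euclidean inner product, quadratic forms and Rayleigh quotients *)

Section InnerProduct.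
Context {R : realType}.

Lemma dotvE {n} (u v : 'cV[R]_n) : dotv u v = (u^T *m v) ord0 ord0.
Proof. by rewrite mxE; apply: eq_bigr => j _; rewrite mxE. Qed.

Lemma dotvC {n} (u v : 'cV[R]_n) : dotv u v = dotv v u.
Proof. by apply: eq_bigr => j _; rewrite mulrC. Qed.

Lemma dotvDl {n} (u v w : 'cV[R]_n) : dotv (u + v) w = dotv u w + dotv v w.
Proof. by rewrite !dotvE raddfD mulmxDl mxE. Qed.

Lemma dotvDr {n} (u v w : 'cV[R]_n) : dotv w (u + v) = dotv w u + dotv w v.
Proof. by rewrite !dotvE mulmxDr mxE. Qed.

Lemma dotvZl {n} (a : R) (u v : 'cV[R]_n) : dotv (a *: u) v = a * dotv u v.
Proof. by rewrite !dotvE linearZ -scalemxAl mxE. Qed.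

Lemma dotvZr {n} (a : R) (u v : 'cV[R]_n) : dotv u (a *: v) = a * dotv u v.
Proof. by rewrite dotvC dotvZl dotvC. Qed.

Lemma dotvNl {n} (u v : 'cV[R]_n) : dotv (- u) v = - dotv u v.
Proof. by rewrite -scaleN1r dotvZl mulN1r. Qed.

Lemma dotvNr {n} (u v : 'cV[R]_n) : dotv u (- v) = - dotv u v.
Proof. by rewrite dotvC dotvNl dotvC. Qed.

Lemma dotv0l {n} (v : 'cV[R]_n) : dotv 0 v = 0.
Proof. by rewrite -(scale0r 0) dotvZl mul0r. Qed.

Definition dotv_lin := (@dotvDl, @dotvDr, @dotvZl, @dotvZr, @dotvNl, @dotvNr).

Lemma dotv_mull {n p} (M : 'M[R]_(n, p)) u v :
  dotv (M *m u) v = dotv u (M^T *m v).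
Proof. by rewrite !dotvE trmx_mul mulmxA. Qed.

Lemma dotv_ge0 {n} (v : 'cV[R]_n) : 0 <= dotv v v.
Proof. by apply: sumr_ge0 => j _; rewrite -expr2 sqr_ge0. Qed.

Lemma sqr_coord_le {n} (v : 'cV[R]_n) j : (v j ord0) ^+ 2 <= dotv v v.
Proof.
rewrite /dotv (bigD1 j) //= -expr2 lerDl.
by apply: sumr_ge0 => i _; rewrite -expr2 sqr_ge0.
Qed.

Lemma dotv_eq0 {n} (v : 'cV[R]_n) : (dotv v v == 0) = (v == 0).
Proof.
apply/eqP/eqP => [v0|->]; last by rewrite dotv0l.
apply/matrixP => j c; rewrite (ord1 c) mxE; apply/eqP.
by rewrite -sqrf_eq0 eq_le sqr_ge0 -v0 sqr_coord_le.
Qed.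

Lemma dotv_gt0 {n} (v : 'cV[R]_n) : v != 0 -> 0 < dotv v v.
Proof. by move=> v0; rewrite lt0r dotv_eq0 v0 dotv_ge0. Qed.

Lemma dotv_col {n p} (a c : 'cV[R]_n) (b d : 'cV[R]_p) :
  dotv (col_mx a b) (col_mx c d) = dotv a c + dotv b d.
Proof. by rewrite !dotvE tr_col_mx mul_row_col mxE. Qed.

Lemma dotvD_le {n} (u v : 'cV[R]_n) :
  dotv (u + v) (u + v) <= 2 * (dotv u u + dotv v v).
Proof.
have := dotv_ge0 (u - v); rewrite !dotv_lin (dotvC v u); lra.
Qed.

Lemma enorm_le {n p} (u : 'cV[R]_n) (v : 'cV[R]_p) (c : R) : 0 <= c ->
  (enorm u <= c * enorm v) = (dotv u u <= c ^+ 2 * dotv v v).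
Proof.
move=> c0; rewrite /enorm -[in LHS](ger0_norm c0) -sqrtr_sqr -sqrtrM ?sqr_ge0 //.
by rewrite ler_sqrt // mulr_ge0 ?sqr_ge0 ?dotv_ge0.
Qed.

(** Each coordinate of [M *m v] is at most the absolute row sum of [M] times the norm of [v]; the
    added 1 keeps the constant positive for [M = 0]. *)
Lemma dotv_mulmx_le {n p} (M : 'M[R]_(n, p)) :
  exists2 C : R, 0 < C & forall v, dotv (M *m v) (M *m v) <= C * dotv v v.
Proof.
exists (1 + \sum_i (\sum_j `|M i j|) ^+ 2) => [|v].
  by rewrite ltr_pwDl // sumr_ge0 // => i _; exact: sqr_ge0.
rewrite mulrDl mul1r -[leLHS]add0r lerD ?dotv_ge0 //.
rewrite mulr_suml; apply: ler_sum => i _; rewrite -expr2.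
rewrite -[dotv v v]sqr_sqrtr ?dotv_ge0 // -exprMn -[leLHS]real_normK ?num_real //.
rewrite ler_sqr ?nnegrE ?mulr_ge0 ?sumr_ge0 ?sqrtr_ge0 //.
rewrite mxE mulr_suml (le_trans (ler_norm_sum _ _ _)) //.
apply: ler_sum => j _; rewrite normrM ler_wpM2l //.
by rewrite -sqrtr_sqr ler_sqrt ?sqr_coord_le ?dotv_ge0.
Qed.

Lemma form_le {n} (M : 'M[R]_n) :
  exists2 C : R, 0 < C & forall v, dotv (M *m v) v <= C * dotv v v.
Proof.
have [C C0 MC] := dotv_mulmx_le M; exists (1 + C) => [|v]; first by rewrite addr_gt0.
have := dotv_ge0 (M *m v - v); have := MC v.
rewrite !dotv_lin (dotvC v (M *m v)) mulrDl; have := dotv_ge0 v.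
have := dotv_ge0 (M *m v); lra.
Qed.

(** This is the upper bound [dotv_mulmx_le] for [invmx M], taken at [M *m v]. *)
Lemma dotv_unitmx_ge {n} (M : 'M[R]_n) : M \in unitmx ->
  exists2 c : R, 0 < c & forall v, c * dotv v v <= dotv (M *m v) (M *m v).
Proof.
move=> uM; have [C C0 MC] := dotv_mulmx_le (invmx M).
exists C^-1 => [|v]; first by rewrite invr_gt0.
rewrite ler_pdivrMl //.
by have := MC (M *m v); rewrite mulKmx.
Qed.

Lemma unitmx_inj {n} (M : 'M[R]_n) :
  (forall v : 'cV[R]_n, M *m v = 0 -> v = 0) -> M \in unitmx.
Proof.
move=> inj; rewrite -unitmx_tr -row_free_unit -kermx_eq0; apply/contraT.
move=> /rowV0Pn[v /sub_kermxP vM v0]; suff : v^T = 0.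
  by move/(congr1 trmx); rewrite trmxK trmx0 => /eqP; rewrite (negPf v0).
by apply: inj; rewrite -[M]trmxK -trmx_mul vM trmx0.
Qed.

(* Evaluate the form at [v - N v / C]. *)
Lemma psd_mulmx_le {n} (N : 'M[R]_n) (C : R) : spsd N -> 0 < C ->
  (forall v, dotv (N *m v) v <= C * dotv v v) ->
  forall v, dotv (N *m v) (N *m v) <= C * dotv (N *m v) v.
Proof.
move=> [sN pN] C0 NC v; rewrite /symmetric_mx in sN.
have := pN (v - C^-1 *: (N *m v)); have := NC (N *m v).
rewrite !(mulmxDr, mulmxN, =^~ scalemxAr) !dotv_lin.
have -> : dotv (N *m (N *m v)) v = dotv (N *m v) (N *m v).
  by rewrite dotv_mull sN.
set a := dotv (N *m v) (N *m v); set b := dotv (N *m (N *m v)) _.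
set q := dotv _ v => bC ge0.
have : 0 <= C * (q - C^-1 * a - (C^-1 * a - C^-1 * (C^-1 * b))).
  apply: mulr_ge0; first exact: ltW.
  by move: ge0; rewrite !(mulrN, mulNr, opprB, opprK); lra.
have -> : C * (q - C^-1 * a - (C^-1 * a - C^-1 * (C^-1 * b))) =
   C * q - 2 * a + C^-1 * b by field; rewrite gt_eqF.
have : C^-1 * b <= a by rewrite ler_pdivrMl.
lra.
Qed.

Lemma spsd_form_eq0 {n} (N : 'M[R]_n) (v : 'cV[R]_n) : spsd N ->
  dotv (N *m v) v = 0 -> N *m v = 0.
Proof.
move=> pN Nv; have [C C0 NC] := form_le N.
apply/eqP; rewrite -dotv_eq0 eq_le dotv_ge0 andbT.
by have := psd_mulmx_le N C pN C0 NC v; rewrite Nv mulr0.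
Qed.

(** Invertibility bounds |Nv|^2 below by a multiple of |v|^2, and [psd_mulmx_le] bounds |Nv|^2 above
    by a multiple of the form. *)
Lemma spsd_unit_ge {n} (N : 'M[R]_n) : spsd N -> N \in unitmx ->
  exists2 c : R, 0 < c & forall v, c * dotv v v <= dotv (N *m v) v.
Proof.
move=> pN uN; have [C C0 NC] := form_le N.
have [c c0 cN] := dotv_unitmx_ge N uN.
exists (C^-1 * c) => [|v]; first by rewrite mulr_gt0 ?invr_gt0.
by rewrite -mulrA ler_pdivrMl // (le_trans (cN v)) // psd_mulmx_le.
Qed.

Lemma spd_spsd {n} (N : 'M[R]_n) : spd N -> spsd N.
Proof.
move=> [sN pN]; split=> // v; have [->|/pN/ltW//] := eqVneq v 0.
by rewrite mulmx0 dotv0l.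
Qed.

Lemma spd_unitmx {n} (N : 'M[R]_n) : spd N -> N \in unitmx.
Proof.
move=> [_ pN]; apply: unitmx_inj => v Nv; apply/eqP/contraT => /pN.
by rewrite Nv dotv0l ltxx.
Qed.

Lemma spsd_unit_spd {n} (N : 'M[R]_n) : spsd N -> N \in unitmx -> spd N.
Proof.
move=> pN uN; split=> [|v v0]; first by case: pN.
have [c c0 cN] := spsd_unit_ge N pN uN.
by apply: lt_le_trans (cN v); rewrite mulr_gt0 ?dotv_gt0.
Qed.

Lemma spd_congr {n p} (N : 'M[R]_n) (X : 'M[R]_(n, p)) : spd N ->
  (forall v : 'cV[R]_p, X *m v = 0 -> v = 0) -> spd (X^T *m N *m X).
Proof.
move=> [sN pN] inj; split=> [|v v0].
  by rewrite /symmetric_mx !trmx_mul trmxK sN mulmxA.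
rewrite -!mulmxA dotv_mull trmxK; apply: pN.
by apply: contra v0 => /eqP/inj ->.
Qed.

Lemma spsd_congr {n p} (N : 'M[R]_n) (X : 'M[R]_(n, p)) : spsd N ->
  spsd (X^T *m N *m X).
Proof.
move=> [sN pN]; split=> [|v].
  by rewrite /symmetric_mx !trmx_mul trmxK sN mulmxA.
by rewrite -!mulmxA dotv_mull trmxK.
Qed.

Lemma spd_invmx {n} (N : 'M[R]_n) : spd N -> spd (invmx N).
Proof.
move=> pN; have uN := spd_unitmx N pN; have [sN _] := pN.
have -> : invmx N = (invmx N)^T *m N *m invmx N.
  by rewrite trmx_inv sN mulVmx // mul1mx.
apply: spd_congr => // v /(congr1 (mulmx N)).
by rewrite mulKVmx // mulmx0.
Qed.

(* The supremum [s] of the Rayleigh quotients is an eigenvalue: otherwise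
   [s%:M - M] is positive definite, hence bounded below, and [s] could be
   decreased. *)
Lemma rayleigh_max {n} (M : 'M[R]_n) : (0 < n)%N -> symmetric_mx M ->
  exists2 s : R, eigenvalue M s & forall v, dotv (M *m v) v <= s * dotv v v.
Proof.
move=> n0 sM; have [C C0 MC] := form_le M.
pose E := [set dotv (M *m v) v / dotv v v | v in [set v : 'cV[R]_n | v != 0]].
have ubE : has_ubound E.
  exists C => _ [v v0 <-]; rewrite ler_pdivrMr ?MC ?dotv_gt0 //.
have E0 : E !=set0.
  pose o : 'cV[R]_n := const_mx 1; exists (dotv (M *m o) o / dotv o o).
  exists o => //=; apply/eqP => /matrixP/(_ (Ordinal n0) ord0).
  by rewrite !mxE => /eqP; rewrite oner_eq0.
pose s := sup E.
have Ms v : dotv (M *m v) v <= s * dotv v v.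
  have [->|v0] := eqVneq v 0; first by rewrite mulmx0 !dotv0l mulr0.
  by rewrite -ler_pdivrMr ?dotv_gt0 //; apply: ub_le_sup => //; exists v.
exists s => //; have NE v : dotv ((s%:M - M) *m v) v = s * dotv v v - dotv (M *m v) v.
  by rewrite mulmxBl mul_scalar_mx !dotv_lin.
have pN : spsd (s%:M - M).
  split=> [|v]; last by rewrite NE subr_ge0.
  by rewrite /symmetric_mx linearB /= tr_scalar_mx sM.
have [uN|] := boolP (s%:M - M \in unitmx).
  have [c c0 cN] := spsd_unit_ge _ pN uN; suff: s <= s - c by lra.
  apply: ge_sup => // _ [v v0 <-]; rewrite ler_pdivrMr ?dotv_gt0 //.
  by have := cN v; rewrite NE mulrBl; lra.
rewrite -row_free_unit -kermx_eq0 => /rowV0Pn[v /sub_kermxP vN v0].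
apply/eigenvalueP; exists v => //; apply/eqP; rewrite eq_sym -subr_eq0.
by rewrite -mul_mx_scalar -mulmxBr vN.
Qed.

(** [eigenvalue] speaks of row eigenvectors; symmetry allows transposing them. *)
Lemma eigenvalue_tr {n} (M : 'M[R]_n) (a : R) : symmetric_mx M -> eigenvalue M a ->
  exists2 v : 'cV[R]_n, M *m v = a *: v & v != 0.
Proof.
move=> sM /eigenvalueP[v vM v0]; exists v^T; last by rewrite trmx_eq0.
by rewrite -[in LHS]sM -trmx_mul vM linearZ.
Qed.

Lemma rayleigh_min {n} (M : 'M[R]_n) : (0 < n)%N -> symmetric_mx M ->
  exists2 s : R, eigenvalue M s & forall v, s * dotv v v <= dotv (M *m v) v.
Proof.
move=> n0 sM; have [||s es Ms] := @rayleigh_max _ (- M) => //.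
  by rewrite /symmetric_mx linearN /= sM.
exists (- s) => [|v].
  have /eigenvalueP[v vM v0] := es; apply/eigenvalueP; exists v => //.
  by rewrite scaleNr -vM mulmxN opprK.
by have := Ms v; rewrite mulNmx dotvNl; lra.
Qed.

(** Every eigenvalue is a Rayleigh quotient, so the eigenvalue [s] of [rayleigh_max] bounds them all
    and the supremum is attained at it. *)
Lemma max_eigenvalue_sym {n} (M : 'M[R]_n) : (0 < n)%N -> symmetric_mx M ->
  eigenvalue M (max_eigenvalue M) /\
  forall v, dotv (M *m v) v <= max_eigenvalue M * dotv v v.
Proof.
move=> n0 sM; have [s es Ms] := rayleigh_max M n0 sM.
suff -> : max_eigenvalue M = s by [].
apply/eqP; rewrite eq_le; apply/andP.
have ub : ubound [set a | eigenvalue M a] s.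
  move=> a /= /(eigenvalue_tr _ _ sM)[v Mv v0]; have := Ms v.
  by rewrite Mv dotvZl ler_pM2r ?dotv_gt0.
split; first by apply: ge_sup => //; exists s.
by apply: ub_le_sup => //; exists s.
Qed.

Lemma min_eigenvalue_sym {n} (M : 'M[R]_n) : (0 < n)%N -> symmetric_mx M ->
  eigenvalue M (min_eigenvalue M) /\
  forall v, min_eigenvalue M * dotv v v <= dotv (M *m v) v.
Proof.
move=> n0 sM; have [s es Ms] := rayleigh_min M n0 sM.
suff -> : min_eigenvalue M = s by [].
apply/eqP; rewrite eq_le; apply/andP.
have lb : lbound [set a | eigenvalue M a] s.
  move=> a /= /(eigenvalue_tr _ _ sM)[v Mv v0]; have := Ms v.
  by rewrite Mv dotvZl ler_pM2r ?dotv_gt0.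
split; first by apply: ge_inf => //; exists s.
by apply: lb_le_inf => //; exists s.
Qed.

Lemma eigenvalue_conj {n} (P M N : 'M[R]_n) : P \in unitmx -> P *m M = N *m P ->
  eigenvalue M =1 eigenvalue N.
Proof.
move=> uP PM a; apply/eigenvalueP/eigenvalueP => -[v vM v0].
  exists (v *m invmx P).
    have PN : invmx P *m N = M *m invmx P.
      by rewrite -[LHS](mulmxK uP) -(mulmxA _ N) -PM mulKmx.
    by rewrite scalemxAl -vM -!mulmxA PN.
  by apply: contra v0 => /eqP vP; rewrite -(mulmxKV uP v) vP mul0mx.
exists (v *m P); first by rewrite -mulmxA PM mulmxA vM scalemxAl.
by apply: contra v0 => /eqP vP; rewrite -(mulmxK uP v) vP mul0mx.
Qed.

End InnerProduct.

(** * Existence of positive semidefinite square roots *)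

Section SquareRoot.
Context {R : realType}.

Lemma tr_mul_dotv {n} (u v : 'cV[R]_n) : u^T *m v = (dotv u v)%:M.
Proof. by rewrite dotvE -mx11_scalar. Qed.

(** [Q] is the reflection in the hyperplane orthogonal to [v - u], which exchanges two vectors of
    equal length. *)
Lemma householder {n} (u v : 'cV[R]_n) : dotv u u = 1 -> dotv v v = 1 ->
  exists2 Q : 'M[R]_n, symmetric_mx Q /\ Q *m Q = 1%:M & Q *m u = v.
Proof.
move=> u1 v1; have [->|vu] := eqVneq v u.
  by exists 1%:M; rewrite /symmetric_mx ?tr_scalar_mx ?mul1mx.
pose w := v - u; have w0 : dotv w w != 0 by rewrite dotv_eq0 subr_eq0.
have ww : dotv w w = - 2 * dotv w u.
  by rewrite !dotv_lin u1 v1 (dotvC u v); ring.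
pose c := 2 / dotv w w.
exists (1%:M - c *: (w *m w^T)).
  split; first by rewrite /symmetric_mx linearB linearZ /= tr_scalar_mx trmx_mul trmxK.
  rewrite mulmxBl mul1mx mulmxBr mulmx1 -scalemxAl -scalemxAr scalerA.
  rewrite -mulmxA [w^T *m _]mulmxA tr_mul_dotv mul_scalar_mx -scalemxAr scalerA.
  rewrite -mulrA mulfVK // mulr_natr -scalerMnl mulr2n.
  by rewrite opprB addrK subrK.
rewrite mulmxBl mul1mx -scalemxAl -mulmxA tr_mul_dotv mul_mx_scalar scalerA.
have -> : c * dotv w u = - 1.
  rewrite ww mulf_eq0 negb_or in w0; have [_ wu0] := andP w0.
  by rewrite /c ww; field.
by rewrite scaleN1r opprK addrC subrK.
Qed.

(* Induction on the order: a Householder reflection moves a unit eigenvector to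
   the first basis vector. *)
Lemma spsd_sqrt {n} (M : 'M[R]_n) : spsd M ->
  exists P : 'M[R]_n, spsd P /\ P *m P = M.
Proof.
elim: n M => [|n IHn] M pM.
  by exists M; split=> //; rewrite [LHS]flatmx0 [RHS]flatmx0.
have [sM posM] := pM.
have [s /(eigenvalue_tr _ _ sM)[v Mv v0] _] := rayleigh_max M (ltn0Sn n) sM.
have s0 : 0 <= s by have := posM v; rewrite Mv dotvZl pmulr_lge0 ?dotv_gt0.
pose u := (Num.sqrt (dotv v v))^-1 *: v.
have u1 : dotv u u = 1.
  rewrite dotvZl dotvZr mulrA -invfM -expr2 sqr_sqrtr ?dotv_ge0 //.
  by rewrite mulVf // dotv_eq0.
have Mu : M *m u = s *: u by rewrite -scalemxAr Mv !scalerA mulrC.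
pose e : 'cV[R]_(1 + n) := col_mx 1%:M 0.
have e1 : dotv e e = 1 by rewrite dotv_col dotv0l addr0 dotvE trmx1 mul1mx mxE.
have [Q [sQ QQ] Qe] := householder e u e1 u1.
pose N : 'M[R]_(1 + n) := Q *m M *m Q.
have Ne : N *m e = s *: e.
  by rewrite -mulmxA Qe -mulmxA Mu -scalemxAr -Qe mulmxA QQ mul1mx.
have [sN pN] : spsd N by rewrite /N -{1}sQ; apply: spsd_congr.
(* [Ne] determines the first column of [N], and symmetry clears the rest of the first row. So [N] is
   block diagonal with blocks [s] and [drsubmx N], and the induction hypothesis applies to the
   latter. *)
rewrite /symmetric_mx -(submxK N) tr_block_mx in sN.
have [_ sur _ sdr] := eq_block_mx sN.
move: Ne; rewrite -(submxK N) mul_block_col !mulmx0 !mulmx1 !addr0 scale_col_mx.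
rewrite scaler0 => /eq_col_mx[Nul Ndl].
have Nur : ursubmx N = 0 by rewrite -sur Ndl trmx0.
have pdr : spsd (drsubmx N).
  split=> // w; have := pN (col_mx 0 w).
  by rewrite -{1}(submxK N) mul_block_col !mulmx0 !add0r dotv_col
    -(dotvC 0) dotv0l add0r.
have [P [[sP posP] PP]] := IHn _ pdr.
pose T : 'M[R]_(1 + n) := block_mx (Num.sqrt s)%:M 0 0 P.
have pT : spsd T.
  split; first by rewrite /symmetric_mx tr_block_mx !trmx0 tr_scalar_mx sP.
  move=> w; rewrite -(vsubmxK w) mul_block_col !mul0mx addr0 add0r dotv_col.
  by rewrite mul_scalar_mx dotvZl addr_ge0 ?mulr_ge0 ?sqrtr_ge0 ?dotv_ge0.
exists (Q *m T *m Q); split; first by rewrite -{1}sQ; apply: spsd_congr.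
rewrite !mulmxA -(mulmxA _ Q Q) QQ mulmx1 -(mulmxA Q T T).
suff -> : T *m T = N by rewrite /N !mulmxA QQ mul1mx -mulmxA QQ mulmx1.
rewrite mulmx_block !(mulmx0, mul0mx, addr0, add0r) PP -scalar_mxM -expr2.
by rewrite sqr_sqrtr // -[RHS](submxK N) Nul Ndl Nur scalemx1.
Qed.

Lemma sqrtmxP {n} (M : 'M[R]_n) : spd M ->
  spsd (sqrtmx M) /\ sqrtmx M *m sqrtmx M = M.
Proof. by move=> /spd_spsd/spsd_sqrt/(xgetPex 0). Qed.

Lemma sqrtmx_sym {n} (M : 'M[R]_n) : spd M -> (sqrtmx M)^T = sqrtmx M.
Proof. by move=> /sqrtmxP[[]]. Qed.

Lemma sqrtmx_unit {n} (M : 'M[R]_n) : spd M -> sqrtmx M \in unitmx.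
Proof.
move=> pM; have := spd_unitmx M pM; have [_ e] := sqrtmxP M pM.
by rewrite -{1}e unitmx_mul => /andP[].
Qed.

End SquareRoot.

(** * The spectral norm and its control by quadratic forms *)

Section SpectralNorm.
Context {R : realType}.

(* Polarize and evaluate at [r v] and [F v]. *)
Lemma sym_form_norm {n} (F : 'M[R]_n) (r : R) : symmetric_mx F -> 0 <= r ->
  (forall v, - r * dotv v v <= dotv (F *m v) v <= r * dotv v v) ->
  forall v, dotv (F *m v) (F *m v) <= r ^+ 2 * dotv v v.
Proof.
move=> sF r0 Fr v.
have polar u w : 2 * dotv (F *m u) w <= r * (dotv u u + dotv w w).
  have /andP[_] := Fr (u + w); have /andP[+ _] := Fr (u - w).
  rewrite !mulmxDr mulmxN !dotv_lin (dotvC w u).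
  have -> : dotv (F *m w) u = dotv (F *m u) w by rewrite dotv_mull sF dotvC.
  lra.
(* For [r = 0] polarization at [v] and [F *m v] already gives [F *m v = 0]; otherwise the factor [r]
   from [r *: v] can be cancelled. *)
have [r_gt0|] := ltP 0 r; last first.
  move=> r_le0; have -> : r = 0 by apply/eqP; rewrite eq_le r_le0.
  have := polar v (F *m v); have -> : r = 0 by apply/eqP; rewrite eq_le r_le0.
  by rewrite expr0n /= !mul0r; lra.
have := polar (r *: v) (F *m v); rewrite -scalemxAr !dotv_lin => le.
have : 2 * dotv (F *m v) (F *m v) <= r * (r * dotv v v) + dotv (F *m v) (F *m v).
  by rewrite -(ler_pM2l r_gt0); lra.
rewrite expr2; lra.
Qed.

Lemma spectral_norm_le {n} (F : 'M[R]_n) (r : R) : 0 <= r ->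
  (forall v, dotv (F *m v) (F *m v) <= r ^+ 2 * dotv v v) -> spectral_norm F <= r.
Proof.
move=> r0 Fr; apply: ge_sup => [|_ [v /= v1 <-]].
  exists (enorm (F *m 0)); exists 0 => //=.
  by rewrite /enorm dotv0l sqrtr0 ler01.
by rewrite (le_trans (y := r * enorm v)) ?enorm_le // ler_piMr.
Qed.

(** The set of values is bounded by [dotv_mulmx_le], so [sup] is a genuine supremum; for [v != 0] it
    is compared with the value at the normalized vector. *)
Lemma enorm_mulmx_le {n} (F : 'M[R]_n) (v : 'cV[R]_n) :
  0 <= spectral_norm F /\ enorm (F *m v) <= spectral_norm F * enorm v.
Proof.
pose E := [set enorm (F *m v) | v in [set v : 'cV[R]_n | enorm v <= 1]].
have [C C0 FC] := dotv_mulmx_le F.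
have ubE : has_ubound E.
  exists (Num.sqrt C) => _ [u /= u1 <-].
  rewrite (le_trans (y := Num.sqrt C * enorm u)) ?ler_piMr ?sqrtr_ge0 //.
  by rewrite enorm_le ?sqrtr_ge0 // sqr_sqrtr ?FC // ltW.
have norm0 : enorm (0 : 'cV[R]_n) = 0 by rewrite /enorm dotv0l sqrtr0.
split.
  by apply: ub_le_sup => //; exists 0; rewrite /= ?mulmx0 norm0.
have [->|v0] := eqVneq v 0; first by rewrite mulmx0 norm0 mulr0.
have nv : 0 < enorm v by rewrite sqrtr_gt0 dotv_gt0.
have enormZ (u : 'cV[R]_n) (a : R) : 0 <= a -> enorm (a *: u) = a * enorm u.
  move=> a0; rewrite /enorm dotvZl dotvZr mulrA -expr2 sqrtrM ?sqr_ge0 //.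
  by rewrite sqrtr_sqr ger0_norm.
have nv' : 0 <= (enorm v)^-1 by rewrite invr_ge0 ltW.
rewrite -ler_pdivrMr // mulrC -enormZ // scalemxAr; apply: ub_le_sup => //.
by exists ((enorm v)^-1 *: v) => //=; rewrite enormZ // mulVf ?gt_eqF.
Qed.

Lemma spectral_norm_ge0 {n} (F : 'M[R]_n) : 0 <= spectral_norm F.
Proof. by have [] := enorm_mulmx_le F 0. Qed.

Lemma spectral_norm_dotv {n} (F : 'M[R]_n) (r : R) : spectral_norm F <= r ->
  forall v, dotv (F *m v) (F *m v) <= r ^+ 2 * dotv v v.
Proof.
move=> Fr v; have [F0 Fv] := enorm_mulmx_le F v.
rewrite -enorm_le; last exact: le_trans Fr.
by apply: le_trans Fv _; apply: ler_wpM2r => //; apply: sqrtr_ge0.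
Qed.

End SpectralNorm.

(** * Contraction of a steepest descent step at the rate of the condition number *)

Section SteepestDescent.
Context {R : realType}.

Lemma eigenvalue_spd_gt0 {n} (M : 'M[R]_n) (a : R) : spd M -> eigenvalue M a -> 0 < a.
Proof.
move=> [sM pM] /(eigenvalue_tr _ _ sM)[v Mv v0]; have := pM v v0.
by rewrite Mv dotvZl pmulr_lgt0 // dotv_gt0.
Qed.

(** The product [invmx Khat *m K] is similar, through the square root of [K], to the symmetric
    matrix [C]. The condition number is thus the ratio of the extreme eigenvalues [mx] and [mn] of
    [C], which also bound its form. *)
Lemma cond_rate_bounds {n} (K Khat : 'M[R]_n) : (0 < n)%N -> spd K -> spd Khat ->
  let C := sqrtmx K *m invmx Khat *m sqrtmx K in
  exists mn mx : R, [/\ 0 < mn, mn <= mx,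
    cond_rate (spectral_cond (invmx Khat *m K)) = (mx - mn) / (mx + mn),
    symmetric_mx C & forall v, mn * dotv v v <= dotv (C *m v) v <= mx * dotv v v].
Proof.
move=> n0 pK pKh C; have [ph hh] := sqrtmxP K pK.
have uh := sqrtmx_unit K pK; have sh := sqrtmx_sym K pK.
have pC : spd C.
  rewrite /C -[X in X *m _ *m _]sh; apply: spd_congr; first exact: spd_invmx.
  by move=> v hv; rewrite -(mulKmx uh v) hv mulmx0.
have [sC _] := pC.
have eC : eigenvalue (invmx Khat *m K) =1 eigenvalue C.
  by apply: (eigenvalue_conj (sqrtmx K)) => //; rewrite -!mulmxA hh.
pose mn := min_eigenvalue C; pose mx := max_eigenvalue C.
have [emn Cmn] := min_eigenvalue_sym C n0 sC.
have [emx Cmx] := max_eigenvalue_sym C n0 sC.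
have mn0 : 0 < mn by apply: eigenvalue_spd_gt0 emn.
have lemn : mn <= mx.
  have [v Cv v0] := eigenvalue_tr _ _ sC emn; have := Cmx v.
  by rewrite Cv dotvZl ler_pM2r ?dotv_gt0.
have -> : spectral_cond (invmx Khat *m K) = mx / mn.
  have eE : [set a | eigenvalue (invmx Khat *m K) a] = [set a | eigenvalue C a].
    by apply/seteqP; split=> a /=; rewrite eC.
  by rewrite /spectral_cond /max_eigenvalue /min_eigenvalue eE.
exists mn, mx; split=> // [|v]; last by rewrite Cmn Cmx.
rewrite /cond_rate; field; rewrite !gt_eqF //; lra.
Qed.

Lemma cond_rate_ge0_lt1 {n} (K Khat : 'M[R]_n) : (0 < n)%N -> spd K -> spd Khat ->
  0 <= cond_rate (spectral_cond (invmx Khat *m K)) < 1.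
Proof.
move=> n0 pK pKh; have [mn [mx [mn0 le -> _ _]]] := cond_rate_bounds K Khat n0 pK pKh.
by apply/andP; split; [apply: divr_ge0|rewrite ltr_pdivrMr ?mul1r]; lra.
Qed.

(* The relaxation parameter minimizes the norm of the residual, so it does at
   least as well as [2 / (mn + mx)]. *)
Lemma steepest_descent {n} (K Khat : 'M[R]_n) (w : 'cV[R]_n) : (0 < n)%N ->
  spd K -> spd Khat ->
  let h := sqrtmx K in
  let r := w - tau_hat K Khat (h *m w) *: (h *m (invmx Khat *m (h *m w))) in
  is_true (dotv r r <= cond_rate (spectral_cond (invmx Khat *m K)) ^+ 2 * dotv w w).
Proof.
move=> n0 pK pKh h; set s := invmx Khat *m (h *m w).
set t := tau_hat _ _ _; set r := w - _; rewrite /=.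
have [mn [mx [mn0 le -> sC Cb]]] := cond_rate_bounds K Khat n0 pK pKh.
have [ph hh] := sqrtmxP K pK; have sh := sqrtmx_sym K pK.
set C := _ *m _ *m _ in sC Cb.
have hs : h *m s = C *m w by rewrite /C !mulmxA.
(* Hence [t] minimizes |w - t C w|^2 over all real parameters. *)
have tE : t = dotv w (C *m w) / dotv (C *m w) (C *m w).
  rewrite /t /tau_hat -/s dotv_mull sh hs; congr (_ / _).
  by rewrite -hh -mulmxA dotv_mull sh hs.
pose t' : R := 2 / (mx + mn).
have mm0 : 0 < mx + mn by lra.
have min : dotv r r <= dotv ((1%:M - t' *: C) *m w) ((1%:M - t' *: C) *m w).
  rewrite /r hs mulmxBl mul1mx -scalemxAl; have [Cw|Cw] := eqVneq (C *m w) 0.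
    by rewrite Cw !scaler0.
  have b0 := dotv_gt0 _ Cw; rewrite !dotv_lin (dotvC (C *m w) w).
  have -> : dotv w (C *m w) = t * dotv (C *m w) (C *m w).
    by rewrite tE divfK // gt_eqF.
  set b := dotv (C *m w) _ in b0 *.
  (* This is exactly the excess of the squared norm at [t'] over that at [t]. *)
  have : 0 <= b * (t' - t) ^+ 2 by rewrite mulr_ge0 ?sqr_ge0 // ltW.
  by clear; nra.
apply: (le_trans min); apply: sym_form_norm.
- by rewrite /symmetric_mx linearB linearZ /= tr_scalar_mx sC.
- by apply: divr_ge0; lra.
move=> v; rewrite mulmxBl mul1mx -scalemxAl !dotv_lin.
have /andP[l u] := Cb v; set q := dotv (C *m v) v in l u *.
have t'0 : 0 < t' by rewrite divr_gt0.
(* The choice of [t'] makes [1 - t' * mx] and [1 - t' * mn] opposite numbers, whose common absolute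
   value is the rate. *)
have e1 : (mx - mn) / (mx + mn) = t' * mx - 1 by rewrite /t'; field; lra.
have e2 : (mx - mn) / (mx + mn) = 1 - t' * mn by rewrite /t'; field; lra.
have l' : t' * (mn * dotv v v) <= t' * q by rewrite ler_pM2l.
have u' : t' * q <= t' * (mx * dotv v v) by rewrite ler_pM2l.
by apply/andP; split; [rewrite e1|rewrite e2]; lra.
Qed.

End SteepestDescent.

(** * Norm bound for the iteration matrix *)

Section IterationMatrix.
Context {R : realType}.

(** The difference of the two sides is the form at [(1 - p) *: a - p *: b]. *)
Lemma spsd_formD {n} (P : 'M[R]_n) (a b : 'cV[R]_n) (p : R) : spsd P ->
  p * (1 - p) * dotv (P *m (a + b)) (a + b) <=
  (1 - p) * dotv (P *m a) a + p * dotv (P *m b) b.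
Proof.
move=> [sP pP]; have := pP ((1 - p) *: a - p *: b).
rewrite !mulmxDr mulmxN -!scalemxAr !dotv_lin.
have -> : dotv (P *m b) a = dotv (P *m a) b by rewrite dotv_mull sP dotvC.
lra.
Qed.

(** Half of the form at [2 *: a + b] is the difference of the two sides. *)
Lemma spsd_formD_ge {n} (P : 'M[R]_n) (a b : 'cV[R]_n) : spsd P ->
  dotv (P *m b) b / 2 - dotv (P *m a) a <= dotv (P *m (a + b)) (a + b).
Proof.
move=> [sP pP]; have := pP (2 *: a + b).
rewrite !mulmxDr -!scalemxAr !dotv_lin.
have -> : dotv (P *m b) a = dotv (P *m a) b by rewrite dotv_mull sP dotvC.
lra.
Qed.

Context {m : nat}.
Implicit Types (U T Sg Q : 'M[R]_m) (u v : 'cV[R]_m) (alpha c mu q : R).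

Lemma iter_mx_sym alpha Sg U T Q : symmetric_mx (invmx Q) ->
  symmetric_mx (iter_mx alpha Sg U T Q).
Proof.
move=> sQ; rewrite /symmetric_mx /iter_mx tr_block_mx.
congr block_mx.
- by rewrite linearZ linearD /= tr_scalar_mx !trmx_mul !trmxK sQ !mulmxA.
- by rewrite linearZ /= !trmx_mul !trmxK sQ !mulmxA.
- by rewrite linearZ /= !trmx_mul !trmxK sQ !mulmxA.
- by rewrite linearN linearB /= tr_scalar_mx !trmx_mul !trmxK sQ !mulmxA.
Qed.

(** This is the splitting diag(alpha, -1) + W^t P W, with [w] the image of [col_mx u v] under W. *)
Lemma iter_mx_form alpha Sg U T Q u v : 0 <= alpha -> spsd (invmx Q) ->
  let w := Num.sqrt alpha *: (U *m (Sg *m u)) + T *m v in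
  dotv (iter_mx alpha Sg U T Q *m col_mx u v) (col_mx u v) =
  alpha * dotv u u - dotv v v + dotv (invmx Q *m w) w.
Proof.
move=> a0 [sP _] w; rewrite /w /iter_mx; set P := invmx Q in sP *.
rewrite mul_block_col dotv_col -!scalemxAl !mulmxDl !mulNmx !mulmxDl !mul1mx.
rewrite !mulNmx -!mulmxA mulmxDr -!scalemxAr !dotv_lin.
rewrite (dotv_mull Sg^T) (dotv_mull U^T) (dotv_mull T^T) !trmxK.
rewrite (dotv_mull Sg^T) (dotv_mull U^T) (dotv_mull T^T) !trmxK.
have := sqr_sqrtr a0; rewrite expr2; set r := Num.sqrt alpha => e.
by rewrite -e; ring.
Qed.

(* With [a0 + b0 < 1] there is [p] with [a0 < p] and [b0 < 1 - p]: the weighted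
   inequality [spsd_formD] for this [p] gives [F < 1]. *)
Lemma iter_mx_norm alpha c mu q : 0 <= alpha < 1 -> 0 <= c -> 0 < mu -> 0 < q ->
  q < 2 * (1 - alpha) / (1 - alpha + 2 * c * alpha) ->
  exists2 rho : R, rho < 1 & forall Sg U T Q,
    spsd (invmx Q) ->
    loewner_le (Sg^T *m U^T *m invmx Q *m U *m Sg)
               (c *: (T^T *m invmx Q *m T)) ->
    (forall v, mu * dotv v v <= dotv (T^T *m invmx Q *m T *m v) v <= q * dotv v v) ->
    spectral_norm (iter_mx alpha Sg U T Q) <= rho.
Proof.
move=> /andP[al0 al1] c10 mu0 q0.
have c1al : 0 <= c * alpha by rewrite mulr_ge0.
rewrite ltr_pdivlMr; last by lra.
move=> qb; have al1' : 0 < 1 - alpha by lra.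
(* In these terms the hypothesis on [q] reads [a0 + b0 < 1]; [p] below is the midpoint between [a0]
   and [1 - b0]. *)
pose a0 := alpha * c * q / (1 - alpha); pose b0 := q / 2.
have a0E : a0 * (1 - alpha) = alpha * c * q by rewrite divfK // gt_eqF.
have a0_ge0 : 0 <= a0 by rewrite divr_ge0 ?mulr_ge0 // ltW.
have ab1 : a0 + b0 < 1.
  rewrite -(ltr_pM2r al1') mulrDl a0E mul1r /b0; lra.
pose p := (a0 + 1 - b0) / 2.
have b0_gt0 : 0 < b0 by rewrite divr_gt0.
have p_gt : a0 < p by rewrite /p; lra.
have p_lt : b0 < 1 - p by rewrite /p; lra.
have p0 : 0 < p by lra.
have p1 : 0 < 1 - p by lra.
have [p_ge0 al1_ge0] := (ltW p0, ltW al1').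
(* For the lower bound, [s] scales down B / 2 - A so that the loss s A is absorbed by alpha |u|^2,
   while s mu / 2 of |v|^2 is gained. *)
pose s := (1 + c * q)^-1.
have c1q : 0 <= c * q by rewrite mulr_ge0 // ltW.
have s0 : 0 < s by rewrite invr_gt0; lra.
have sE : s + s * (c * q) = 1 by rewrite /s; field; rewrite gt_eqF //; lra.
have s_cq : 0 <= s * (c * q) by rewrite mulr_ge0 // ltW.
(* [r1] and [r2] are the coefficients of |u|^2 and |v|^2 in the upper bound of the form; [r3] comes
   from the lower bound. *)
pose r1 := alpha + a0 * (1 - alpha) / p.
pose r2 := b0 / (1 - p) * 2 - 1.
pose r3 := 1 - s * (mu / 2).
have r1_0 : 0 <= r1 by rewrite addr_ge0 // divr_ge0 // mulr_ge0.
have r1_1 : r1 < 1.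
  suff : a0 * (1 - alpha) / p < 1 - alpha by rewrite /r1; lra.
  by rewrite ltr_pdivrMr // mulrC ltr_pM2l.
have r2_1 : r2 < 1.
  suff : b0 / (1 - p) < 1 by rewrite /r2; lra.
  by rewrite ltr_pdivrMr // mul1r.
have r3_1 : r3 < 1 by rewrite /r3 gtrBl mulr_gt0 ?divr_gt0.
pose rho := Num.max r1 (Num.max r2 r3).
have rr1 : r1 <= rho by rewrite le_max lexx.
have rr2 : r2 <= rho by rewrite !le_max lexx orbT.
have rr3 : r3 <= rho by rewrite !le_max lexx !orbT.
have rho0 : 0 <= rho by apply: le_trans rr1.
exists rho => [|Sg U T Q pP NM Mb]; first by rewrite !gt_max r1_1 r2_1.
apply: spectral_norm_le => //; apply: sym_form_norm => //.
  by apply: iter_mx_sym; case: pP.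
move=> w; rewrite -(vsubmxK w); set u := usubmx w; set v := dsubmx w.
rewrite iter_mx_form // dotv_col.
set a := _ *: _; set b := T *m v.
have pa : dotv (invmx Q *m a) a <= alpha * c * q * dotv u u.
  have /andP[_ Mu] := Mb u; have := NM u.
  rewrite -!mulmxA (dotv_mull Sg^T) (dotv_mull U^T) !trmxK.
  rewrite -scalemxAl dotvZl -mulmxA => Nu.
  rewrite /a -scalemxAr dotvZl dotvZr mulrA -expr2 sqr_sqrtr // -!mulrA.
  apply: ler_wpM2l => //; apply: le_trans Nu _; apply: ler_wpM2l => //.
  by rewrite !mulmxA in Mu *.
have /andP[] := Mb v; rewrite -!mulmxA (dotv_mull T^T) trmxK -/b => lb ub.
have := spsd_formD _ a b p pP; have := spsd_formD_ge _ a b pP.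
have [_ posP] := pP; have := posP (a + b).
move: pa lb ub; set A := dotv _ a; set B := dotv _ b; set W := dotv _ (a + b).
have := dotv_ge0 u; have := dotv_ge0 v; set x := dotv u u; set y := dotv v v.
move=> y0 x0 Ax By yB W0 Wge Wle; apply/andP; split.
  have : s * (B / 2 - A) <= W.
    have [BA|BA] := lerP 0 (B / 2 - A).
      by apply: le_trans Wge; rewrite ler_piMl //; lra.
    by apply: le_trans W0; rewrite mulr_ge0_le0 // ltW.
  have : s * A <= alpha * (s * (c * q)) * x.
    have -> : alpha * (s * (c * q)) * x = s * (alpha * c * q * x) by ring.
    by rewrite ler_pM2l.
  have : s * (mu / 2 * y) <= s * (B / 2) by rewrite ler_pM2l //; lra.
  have : r3 * y <= rho * y by rewrite ler_wpM2r.
  have : 0 <= rho * x by rewrite mulr_ge0.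
  have : alpha * (s * (c * q)) * x <= alpha * x.
    by rewrite ler_wpM2r // ler_piMr //; lra.
  rewrite /r3; lra.
have W_le : W <= A / p + B / (1 - p).
  rewrite -(ler_pM2l (mulr_gt0 p0 p1)) (le_trans Wle) //.
  rewrite le_eqVlt; apply/orP; left; apply/eqP; field.
  by rewrite !gt_eqF.
have : A / p <= a0 * (1 - alpha) / p * x.
  by rewrite a0E mulrAC ler_pM2r ?invr_gt0.
have : B / (1 - p) <= b0 / (1 - p) * 2 * y.
  rewrite [b0 / _]mulrC -!mulrA mulrC ler_pM2l ?invr_gt0 //.
  by rewrite /b0; lra.
have : r2 * y <= rho * y by rewrite ler_wpM2r.
have : r1 * x <= rho * x by rewrite ler_wpM2r.
rewrite /r1 /r2; lra.
Qed.

End IterationMatrix.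

(** * Spectral bounds for the preconditioned Schur complement *)

Section Preconditioner.
Context {R : realType}.

Lemma spsdD {n} (M N : 'M[R]_n) : spsd M -> spsd N -> spsd (M + N).
Proof.
move=> [sM pM] [sN pN]; split=> [|v].
  by rewrite /symmetric_mx linearD /= sM sN.
by rewrite mulmxDl dotvDl addr_ge0.
Qed.

(** Where the form of [schur Ahat B D] vanishes, both summands vanish, so that [B *m v = 0] and
    [D *m v = 0]. Then the form of [schur A B D] vanishes at [v] as well. *)
Lemma schur_spd {n m} (A Ahat : 'M[R]_n) (B : 'M[R]_(n, m)) (D : 'M[R]_m) :
  spd Ahat -> spsd D -> spd (schur A B D) -> spd (schur Ahat B D).
Proof.
move=> pAh pD [_ pS].
have pB : spsd (B^T *m invmx Ahat *m B) by apply/spsd_congr/spd_spsd/spd_invmx.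
have [sH pH] := spsdD _ _ pB pD; split=> // v v0.
rewrite lt0r pH andbT; apply/contraNneq: (v0) => /eqP.
rewrite mulmxDl dotvDl paddr_eq0; [|exact: pB.2|exact: pD.2].
move=> /andP[/eqP + /eqP/(spsd_form_eq0 _ _ pD) Dv].
rewrite -!mulmxA dotv_mull trmxK => Bv.
have {}Bv : B *m v = 0.
  apply/eqP/contraT => /(proj2 (spd_invmx _ pAh)).
  by rewrite Bv ltxx.
have := pS v v0; rewrite /schur mulmxDl dotvDl Dv -!mulmxA Bv !mulmx0.
by rewrite !dotv0l addr0 ltxx.
Qed.

(** For a row eigenvector [v] with eigenvalue [a], the form of B^t Ahat^-1 B at D^-1 v^t is [a]
    times a positive number. *)
Lemma gen_max_eigenvalue_ge0 {n m} (Ahat : 'M[R]_n) (B : 'M[R]_(n, m))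
  (D : 'M[R]_m) : spd Ahat -> spsd D -> (0 <= gen_max_eigenvalue Ahat B D)%E.
Proof.
move=> pAh pD; rewrite /gen_max_eigenvalue; case: ifP => // uD.
have pDi := spd_invmx _ (spsd_unit_spd _ pD uD).
have [sB pB] : spsd (B^T *m invmx Ahat *m B).
  by apply/spsd_congr/spd_spsd/spd_invmx.
rewrite lee_fin /max_eigenvalue; set E := [set a | _].
have E0 a : E a -> 0 <= a.
  move=> /eigenvalueP[v vM v0].
  have Dv : 0 < dotv (invmx D *m v^T) v^T by apply: pDi.2; rewrite trmx_eq0.
  have := pB (invmx D *m v^T).
  have -> : B^T *m invmx Ahat *m B *m (invmx D *m v^T) = a *: v^T.
    by rewrite -[in RHS]linearZ /= -vM 2!trmx_mul sB pDi.1 mulmxA.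
  by rewrite dotvZl dotvC pmulr_lge0.
have [sE|nE] := pselect (has_sup E); last by rewrite sup_out.
have [[a Ea] ubE] := sE; apply: le_trans (E0 a Ea) _; exact: ub_le_sup.
Qed.

Lemma delta_gt0 (lam : R) (c : \bar R) : 0 < lam -> (0 <= c)%E -> 0 < delta lam c.
Proof.
move=> lam0; case: c => [r||] /=; rewrite ?invr_gt0 // lee_fin => r0.
by rewrite divr_gt0 ?mulr_gt0 //; lra.
Qed.

(** [invmx] is an involution on all matrices, since it fixes the singular ones. *)
Lemma invmx_damped {m} (t : R) (G : 'M[R]_m) :
  invmx (damped_mx t G) = t *: invmx G.
Proof. exact: invmxK. Qed.

(** The numerator is a steepest descent step from H^(-1/2) g. When that vector vanishes, the
    quotient is 0 by the convention on division by 0. *)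
Lemma beta_step_le {m} (H Shat : 'M[R]_m) (g : 'cV[R]_m) : (0 < m)%N ->
  spd H -> spd Shat ->
  beta_step H Shat g <= cond_rate (spectral_cond (invmx Shat *m H)).
Proof.
move=> m0 pH pSh; rewrite /beta_step; set v := invmx _ *m g.
have /andP[b0 _] := cond_rate_ge0_lt1 H Shat m0 pH pSh.
have [v0|v0] := eqVneq (enorm v) 0; first by rewrite v0 invr0 mulr0.
rewrite ler_pdivrMr ?lt0r ?v0 ?sqrtr_ge0 // enorm_le //.
have := steepest_descent H Shat v m0 pH pSh.
rewrite /= [sqrtmx H *m v]mulKVmx ?sqrtmx_unit //.
rewrite mulmxBl mul1mx -scalemxAl -!mulmxA [sqrtmx H *m v]mulKVmx ?sqrtmx_unit //.
Qed.

(** As [h *m h] and [T *m T^T] both equal [S], the matrix h^-1 T is orthogonal: it keeps norms and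
    carries the form of T^t P T to that of [C]. *)
Lemma precond_bounds {m} (S T P : 'M[R]_m) (l u : R) : (0 < m)%N -> spd S ->
  S = T *m T^T -> symmetric_mx P ->
  (forall a, eigenvalue (sqrtmx S *m P *m sqrtmx S) a -> l <= a <= u) ->
  forall v, l * dotv v v <= dotv (T^T *m P *m T *m v) v <= u * dotv v v.
Proof.
move=> m0 pS ST sP eig v; have [_ hh] := sqrtmxP S pS.
have sh := sqrtmx_sym S pS; have uh := sqrtmx_unit S pS.
set h := sqrtmx S in sh uh hh eig; set C := h *m P *m h in eig.
have sC : symmetric_mx C by rewrite /symmetric_mx !trmx_mul sh sP mulmxA.
have [emn Cmn] := min_eigenvalue_sym C m0 sC.
have [emx Cmx] := max_eigenvalue_sym C m0 sC.
pose w := invmx h *m (T *m v).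
have hw : h *m w = T *m v by rewrite mulKVmx.
have uT : T \in unitmx.
  by have := spd_unitmx _ pS; rewrite ST unitmx_mul => /andP[].
have ww : dotv w w = dotv v v.
  have Tw : T^T *m (invmx h *m w) = v.
    rewrite -[LHS](mulKmx uT) [T *m _]mulmxA -ST -hh -mulmxA mulKVmx // hw.
    by rewrite mulKmx.
  by rewrite {1}/w dotv_mull trmx_inv sh dotv_mull Tw.
have -> : dotv (T^T *m P *m T *m v) v = dotv (C *m w) w.
  by rewrite -!mulmxA hw (dotv_mull h) sh hw dotv_mull trmxK.
have /andP[le_mn _] := eig _ emn; have /andP[_ le_mx] := eig _ emx.
rewrite -ww; apply/andP; split.
  by apply: le_trans (Cmn w); rewrite ler_wpM2r ?dotv_ge0.
by apply: le_trans (Cmx w) _; rewrite ler_wpM2r ?dotv_ge0.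
Qed.

(** The constant depends on [T] and [q] only, so it serves for the varying matrices Q_i^-1 at
    once. *)
Lemma form_bounds_mulmx_le {m} (T : 'M[R]_m) (q : R) : T \in unitmx -> 0 < q ->
  exists2 C : R, 0 < C & forall P, spsd P ->
    (forall v, dotv (T^T *m P *m T *m v) v <= q * dotv v v) ->
    forall v, dotv (P *m v) (P *m v) <= C * dotv v v.
Proof.
move=> uT q0; have [C C0 TC] := dotv_mulmx_le (invmx T).
have qC : 0 < q * C by rewrite mulr_gt0.
exists ((q * C) * (q * C)) => [|P pP Pq v]; first by rewrite mulr_gt0.
have PC w : dotv (P *m w) w <= q * C * dotv w w.
  have := Pq (invmx T *m w); rewrite -!mulmxA mulKVmx // dotv_mull trmxK mulKVmx //.
  by move/le_trans; apply; rewrite -mulrA ler_pM2l.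
by apply: le_trans (psd_mulmx_le _ _ pP qC PC v) _; rewrite -[leRHS]mulrA ler_pM2l.
Qed.

End Preconditioner.

(** * Geometric convergence and one step in transformed coordinates *)

Section Convergence.
Context {R : realType}.

(** Convergence is coordinatewise, and coordinates are bounded by the Euclidean norm. The index
    [i.+1] fits an error bounded by the energy of the preceding step. *)
Lemma cvg_geometric_dotv {n} (u : nat -> 'cV[R]_n) (l : 'cV[R]_n) (C r : R) :
  0 <= r < 1 -> (forall i, dotv (u i.+1 - l) (u i.+1 - l) <= C * r ^+ i) ->
  u @ \oo --> l.
Proof.
move=> /andP[r0 r1] uC; rewrite -cvg_shiftS; apply/cvg_ballP => e e0.
have Cr : geometric C r @ \oo --> (0 : R) by apply: cvg_geometric; rewrite ger0_norm.
have /cvgrPdist_lt/(_ (e ^+ 2)) := Cr; rewrite exprn_gt0 // => /(_ isT).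
apply: filterS => i /=; rewrite sub0r normrN => Ci; split=> // j c.
rewrite (ord1 c) /ball /= distrC -ltr_sqr ?nnegrE ?(ltW e0) // real_normK ?num_real //.
have := sqr_coord_le (u i.+1 - l) j; rewrite !mxE => /le_lt_trans; apply.
by apply: le_lt_trans (uC i) _; apply: le_lt_trans Ci; exact: ler_norm.
Qed.

Context {m k : nat}.
Implicit Types (Sg U T Q P : 'M[R]_m) (eta : 'cV[R]_m) (z zh : 'cV[R]_(m + k)).

(* One step of the iteration in the coordinates [z = V^t A^(-1/2) f_i] and
   [eta = T^t (y - y_i)]; [zh] is the value of [z] after the update of [x]. *)
Definition zstep Sg U T P zh eta :=
  let Si : 'M[R]_(m, m + k) := row_mx Sg 0 in
  zh + Si^T *m (U^T *m (P *m (U *m (Si *m zh) - T *m eta))).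

Definition etastep Sg U T P zh eta :=
  let Si : 'M[R]_(m, m + k) := row_mx Sg 0 in
  eta + T^T *m (P *m (U *m (Si *m zh) - T *m eta)).

Lemma zstep_le Sg U T (q : R) : T \in unitmx -> 0 < q ->
  exists2 C : R, 0 < C & forall P, spsd P ->
    (forall v, dotv (T^T *m P *m T *m v) v <= q * dotv v v) ->
    forall zh eta, dotv (zstep Sg U T P zh eta) (zstep Sg U T P zh eta) <=
      C * (dotv zh zh + dotv eta eta).
Proof.
move=> uT q0; pose Si : 'M[R]_(m, m + k) := row_mx Sg 0.
have [Cp Cp0 PC] := form_bounds_mulmx_le T q uT q0.
have [Cl Cl0 LC] := dotv_mulmx_le (Si^T *m U^T).
have [Cu Cu0 UC] := dotv_mulmx_le (U *m Si).
have [Ct Ct0 TC] := dotv_mulmx_le (- T).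
have CC0 : 0 < Cl * Cp * (2 * (Cu + Ct)) by rewrite !mulr_gt0 // addr_gt0.
exists (2 * (1 + Cl * Cp * (2 * (Cu + Ct)))) => [|P pP Pq zh eta].
  by rewrite mulr_gt0 // addr_gt0.
rewrite /zstep; set b := U *m _ - _.
have bE : dotv b b <= 2 * (Cu + Ct) * (dotv zh zh + dotv eta eta).
  apply: (le_trans (dotvD_le _ _)).
  have := UC zh; have := TC eta; rewrite mulNmx -mulmxA => h1 h2.
  rewrite -mulrA ler_pM2l // mulrDl !mulrDr.
  have := mulr_ge0 (ltW Cu0) (dotv_ge0 eta).
  have := mulr_ge0 (ltW Ct0) (dotv_ge0 zh); lra.
apply: (le_trans (dotvD_le _ _)); rewrite -mulrA ler_pM2l // mulrDl mul1r.
rewrite -addrA lerD2l -[leLHS]add0r lerD ?dotv_ge0 //.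
have := LC (P *m b); rewrite -[in X in X -> _]mulmxA => /le_trans; apply.
rewrite -!mulrA ler_pM2l //; apply: le_trans (PC P pP Pq b) _.
by rewrite ler_pM2l // mulrA.
Qed.

(* On the first [m] coordinates the step is the matrix [F] up to the scaling
   [diag(sqrt alpha, 1)] and signs; on the others it is multiplication by [alpha]. *)
Lemma step_contraction Sg U T Q (alpha rho r : R) z zh eta : 0 <= alpha -> 0 <= r ->
  alpha <= r -> rho <= r -> spectral_norm (iter_mx alpha Sg U T Q) <= rho ->
  dotv zh zh <= alpha ^+ 2 * dotv z z ->
  let z' := zstep Sg U T (invmx Q) zh eta in
  let eta' := etastep Sg U T (invmx Q) zh eta in
  is_true (alpha * dotv z' z' + dotv eta' eta' <=
  r ^+ 2 * (alpha * dotv z z + dotv eta eta)).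
Proof.
move=> al0 r0 alr rhor Frho zhz z' eta'; set P := invmx Q in z' eta' *.
(* [zt] stands for [zh] divided by [alpha]; for [alpha = 0] the contraction forces [zh = 0], and
   [zt = 0] serves. *)
have [zt [zhE ztz]] : exists zt, zh = alpha *: zt /\ dotv zt zt <= dotv z z.
  have [a0|a0] := eqVneq alpha 0.
    exists 0; rewrite dotv0l dotv_ge0 scaler0; split=> //.
    apply/eqP; rewrite -dotv_eq0 eq_le dotv_ge0 andbT.
    by move: zhz; rewrite a0 expr0n /= mul0r.
  exists (alpha^-1 *: zh); rewrite scalerA divff // scale1r; split=> //.
  rewrite dotvZl dotvZr mulrA -invfM -expr2 ler_pdivrMl //.
  by rewrite lt0r sqrf_eq0 a0 sqr_ge0.
pose a := usubmx zt; pose b := dsubmx zt; pose sa := Num.sqrt alpha.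
have saE : sa * sa = alpha by rewrite -expr2 sqr_sqrtr.
have UzE : U *m (row_mx Sg (0 : 'M[R]_(m, k)) *m zh) = alpha *: (U *m (Sg *m a)).
  rewrite zhE -[zt]vsubmxK -!scalemxAr mul_row_col mul0mx addr0.
  by rewrite -/a.
pose z1 := alpha *: a + Sg^T *m (U^T *m (P *m (alpha *: (U *m (Sg *m a)) - T *m eta))).
have z'E : z' = col_mx z1 (alpha *: b).
  rewrite /z1 /z' /zstep UzE tr_row_mx trmx0 mul_col_mx mul0mx zhE.
  by rewrite -[X in alpha *: X]vsubmxK scale_col_mx add_col_mx addr0.
have FE : iter_mx alpha Sg U T Q *m col_mx (sa *: a) (- eta) =
    col_mx (sa *: z1) eta'.
  rewrite /z1 mul_block_col -/P -/sa; congr col_mx.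
    rewrite -scalemxAl mulmxDl mul1mx -!mulmxA -!scalemxAl -!mulmxA.
    rewrite !mulmxDr !mulmxN -!scalemxAr.
    rewrite !scalerDr !scalerN !scalerA.
    rewrite -addrA; congr (_ + (_ - _)).
      by rewrite mulrC.
    by rewrite mulrC.
  rewrite /eta' /etastep UzE mulNmx mulmxN opprK mulmxBl mul1mx -!mulmxA.
  rewrite !mulmxDr !mulmxN -!scalemxAr -!scalemxAl -!mulmxA scalerA saE.
  by rewrite addrCA.
have := spectral_norm_dotv _ _ Frho (col_mx (sa *: a) (- eta)).
rewrite FE z'E !dotv_col.
rewrite (dotvZl sa) (dotvZr sa) !mulrA saE dotvNl dotvNr opprK.
rewrite (dotvZl sa) (dotvZr sa) !mulrA saE.
rewrite (dotvZl alpha b) (dotvZr alpha b).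
move: ztz; rewrite -[zt]vsubmxK dotv_col -/a -/b.
have := dotv_ge0 a; have := dotv_ge0 b; have := dotv_ge0 eta.
set x := dotv a a; set y := dotv b b; set e := dotv eta eta.
set Z := dotv z z => e0 y0 x0 xyZ Fle.
have rho0 : 0 <= rho by apply: le_trans Frho; apply: spectral_norm_ge0.
have rr : rho ^+ 2 <= r ^+ 2 by rewrite ler_sqr ?nnegrE.
have aa : alpha ^+ 2 <= r ^+ 2 by rewrite ler_sqr ?nnegrE.
have e1 : rho ^+ 2 * (alpha * x + e) <= r ^+ 2 * (alpha * x + e).
  by rewrite ler_wpM2r // addr_ge0 ?mulr_ge0.
have e2 : alpha ^+ 2 * (alpha * y) <= r ^+ 2 * (alpha * y).
  by rewrite ler_wpM2r ?mulr_ge0.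
have e3 : r ^+ 2 * (alpha * (x + y)) <= r ^+ 2 * (alpha * Z).
  by rewrite ler_wpM2l ?sqr_ge0 // ler_wpM2l.
lra.
Qed.

End Convergence.

(** * The Uzawa step and its errors in transformed coordinates *)

Section UzawaStep.
Context {R : realType}.

(** Replacing beta_i by its bound [beta] makes the constants independent of the residual. *)
Lemma damped_form_bounds {m} (S H Shat T G : 'M[R]_m) (d1 d2 t : R) (g : 'cV[R]_m) :
  (0 < m)%N -> spd S -> spd H -> spd Shat -> S = T *m T^T ->
  0 < d1 -> 0 < d2 -> 0 < t -> local_precond S H Shat d1 d2 g G ->
  let P := invmx (damped_mx t G) in
  let beta := cond_rate (spectral_cond (invmx Shat *m H)) in
  spsd P /\ forall v, t * (1 - beta) * d1 * dotv v v <=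
    dotv (T^T *m P *m T *m v) v <= t * (1 + beta) * d2 * dotv v v.
Proof.
move=> m0 pS pH pSh ST d10 d20 t0 [pG _ eig] P beta.
have pGi := spd_invmx _ pG; have bi := beta_step_le H Shat g m0 pH pSh.
have PE : P = t *: invmx G := invmx_damped t G.
split=> [|v].
  have [sG posG] := spd_spsd _ pGi; rewrite PE; split=> [|v].
    by rewrite /symmetric_mx linearZ /= sG.
  by rewrite -scalemxAl dotvZl mulr_ge0 // ltW.
have /andP[l u] := precond_bounds _ T _ _ _ m0 pS ST pGi.1 eig v.
rewrite PE -scalemxAr -!scalemxAl dotvZl -!mulrA !ler_pM2l //.
apply/andP; split.
  apply: le_trans l; rewrite mulrA ler_wpM2r ?dotv_ge0 // ler_pM2r //.
  by rewrite lerD2l lerN2.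
apply: le_trans u _; rewrite mulrA ler_wpM2r ?dotv_ge0 // ler_pM2r //.
by rewrite lerD2l.
Qed.

Lemma loewner_scale_ge0 {m} (N M : 'M[R]_m) (c : R) : (0 < m)%N ->
  (forall v, 0 <= dotv (N *m v) v) ->
  (forall v, v != 0 -> 0 < dotv (M *m v) v) -> loewner_le N (c *: M) -> 0 <= c.
Proof.
move=> m0 N0 M0 NM; pose o : 'cV[R]_m := const_mx 1.
have o0 : o != 0.
  apply/eqP => /matrixP/(_ (Ordinal m0) ord0).
  by rewrite !mxE => /eqP; rewrite oner_eq0.
have := le_trans (N0 o) (NM o); rewrite -scalemxAl dotvZl.
by rewrite pmulr_lge0 // M0.
Qed.

Context {m k : nat}.
Variables (A Ahat : 'M[R]_(m + k)) (B : 'M[R]_(m + k, m)) (D : 'M[R]_m).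
Variables (f : 'cV[R]_(m + k)) (g : 'cV[R]_m).
Variables (xsol : 'cV[R]_(m + k)) (ysol : 'cV[R]_m).
Variables (U T : 'M[R]_m) (V : 'M[R]_(m + k)) (Sg : 'M[R]_m).
Hypotheses (m_gt0 : (0 < m)%N) (pA : spd A) (pAhat : spd Ahat).
Hypothesis xsolE : A *m xsol + B *m ysol = f.
Hypothesis ysolE : B^T *m xsol - D *m ysol = g.
Hypothesis orthV : orthogonal_mx V.
Hypothesis svd :
  B^T *m invmx (sqrtmx A) = U *m row_mx Sg (0 : 'M[R]_(m, k)) *m V^T.
Hypotheses (uT : T \in unitmx) (ST : schur A B D = T *m T^T).

Definition zcoord x y := V^T *m (invmx (sqrtmx A) *m res_x A B f x y).
Definition etacoord y := T^T *m (ysol - y).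

Let h := sqrtmx A.
Let hh : h *m h = A. Proof. by have [] := sqrtmxP A pA. Qed.
Let sh : h^T = h. Proof. exact: sqrtmx_sym. Qed.
Let uh : h \in unitmx. Proof. exact: sqrtmx_unit. Qed.
Let VVt : V *m V^T = 1%:M. Proof. exact: mulmx1C. Qed.

(** As f_i = A (xsol - x) + B (ysol - y), the singular value decomposition turns B^t A^-1 f_i into U
    Sigma z; adding the residual gives S (ysol - y), that is [T *m etacoord y]. *)
Lemma res_yE (x : 'cV[R]_(m + k)) y :
  res_y B D g x y = T *m etacoord y - U *m (row_mx Sg 0 *m zcoord x y).
Proof.
have -> : U *m (row_mx Sg 0 *m zcoord x y) =
    B^T *m (xsol - x) + B^T *m invmx A *m B *m (ysol - y).
  rewrite /zcoord !mulmxA -svd -/h -mulmxA.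
  have -> : res_x A B f x y = A *m (xsol - x) + B *m (ysol - y).
    rewrite /res_x -xsolE !mulmxBr.
    move: (A *m xsol) (B *m ysol) (A *m x) (B *m y) => a b c d.
    by apply/matrixP => i j; rewrite !mxE; ring.
  have hiA : invmx h *m (invmx h *m A) = 1%:M by rewrite -hh mulKmx // mulVmx.
  have AiE : invmx h *m invmx h = invmx A.
    by rewrite -[LHS](mulmxK (spd_unitmx A pA)) -(mulmxA _ _ A) hiA mul1mx.
  rewrite -!mulmxA (mulmxA (invmx h) (invmx h)) AiE.
  by rewrite mulmxDr mulKmx ?spd_unitmx // mulmxDr !mulmxA.
rewrite /etacoord [T *m _]mulmxA -ST /schur mulmxDl /res_y -ysolE.
rewrite !(mulmxBr D) !(mulmxBr B^T).
move: (B^T *m invmx A *m B *m (ysol - y)) (B^T *m xsol) (B^T *m x).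
move: (D *m ysol) (D *m y) => d e a b c.
by apply/matrixP => i j; rewrite !mxE; ring.
Qed.

(** The witness is the coordinate after the update of [x] alone: a steepest descent step for
    A^(-1/2) f_i, rotated by V^t. The update of [y] then enters through [res_yE] and A^(-1/2) B = V
    Sigma^t U^t. *)
Lemma uzawa_step_coord x y x' y' (P : 'M[R]_m) :
  x' = x + omega_step A Ahat (res_x A B f x y) *: (invmx Ahat *m res_x A B f x y) ->
  y' = y + P *m res_y B D g x' y ->
  exists zh, [/\
    dotv zh zh <= cond_rate (spectral_cond (invmx Ahat *m A)) ^+ 2 *
      dotv (zcoord x y) (zcoord x y),
    zcoord x' y' = zstep Sg U T P zh (etacoord y) &
    etacoord y' = etastep Sg U T P zh (etacoord y)].
Proof.
move=> x'E y'E; exists (zcoord x' y); set gi := res_y B D g x' y in y'E.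
have giE : U *m (row_mx Sg 0 *m zcoord x' y) - T *m etacoord y = - gi.
  by rewrite /gi res_yE opprB.
have dotV w : dotv (V^T *m w) (V^T *m w) = dotv w w.
  by rewrite dotv_mull trmxK mulmxA VVt mul1mx.
split.
- rewrite !dotV -/h; set fi := res_x A B f x y in x'E *.
  have n0 : (0 < m + k)%N by rewrite addn_gt0 m_gt0.
  have := steepest_descent A Ahat (invmx h *m fi) n0 pA pAhat.
  rewrite /= -/h mulKVmx //.
  suff -> : invmx h *m res_x A B f x' y =
      invmx h *m fi - tau_hat A Ahat fi *: (h *m (invmx Ahat *m fi)) by [].
  have -> : res_x A B f x' y = fi - omega_step A Ahat fi *: (A *m (invmx Ahat *m fi)).
    rewrite /res_x x'E mulmxDr -scalemxAr /fi /res_x -/fi.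
    by rewrite -!addrA; congr (_ + _); rewrite !opprD -addrA addrCA addrC !addrA.
  have hA w : invmx h *m (A *m w) = h *m w by rewrite -hh -mulmxA mulKmx.
  by rewrite mulmxBr -scalemxAr hA.
- clearbody gi; rewrite /zstep giE !mulmxN /zcoord -/h.
  have -> : res_x A B f x' y' = res_x A B f x' y - B *m (P *m gi).
    by rewrite /res_x y'E mulmxDr addrA opprD addrA.
  rewrite !mulmxBr; congr (_ - _); rewrite (mulmxA (invmx h)).
  have -> : invmx h *m B = V *m ((row_mx Sg 0)^T *m U^T).
    by rewrite -[LHS]trmxK trmx_mul trmx_inv sh svd !trmx_mul trmxK.
  by rewrite -(mulmxA V) (mulmxA V^T) orthV mul1mx !mulmxA.
- by rewrite /etastep giE !mulmxN /etacoord y'E opprD addrA mulmxBr mulmxA.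
Qed.

(** Both errors are linear in the coordinates: ysol - y = T^-t eta and xsol - x = A^-1 (f_i - B
    (ysol - y)), with f_i = A^(1/2) V z. *)
Lemma sol_errors : exists2 C : R, 0 < C & forall x y,
  let e := dotv (zcoord x y) (zcoord x y) + dotv (etacoord y) (etacoord y) in
  dotv (x - xsol) (x - xsol) <= C * e /\ dotv (y - ysol) (y - ysol) <= C * e.
Proof.
have [Cy Cy0 YC] := dotv_mulmx_le (- invmx T^T).
have [Cz Cz0 ZC] := dotv_mulmx_le (- (invmx A *m h *m V)).
have [Cx Cx0 XC] := dotv_mulmx_le (invmx A *m B *m invmx T^T).
have uTt : T^T \in unitmx by rewrite unitmx_tr.
exists (Cy + 2 * (Cz + Cx)) => [|x y e].
  by rewrite addr_gt0 // mulr_gt0 // addr_gt0.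
rewrite /e; set z := zcoord x y; set eta := etacoord y.
have z0 := dotv_ge0 z; have eta0 := dotv_ge0 eta.
have yE : y - ysol = - invmx T^T *m eta by rewrite mulNmx mulKmx // opprB.
have xE : x - xsol = - (invmx A *m h *m V) *m z + (invmx A *m B *m invmx T^T) *m eta.
  rewrite mulNmx -!mulmxA mulKmx // (mulmxA V) VVt mul1mx mulKVmx //.
  rewrite /res_x -xsolE -!mulmxN -mulmxDr !mulmxBr.
  rewrite -[LHS](mulKmx (spd_unitmx A pA)); congr (_ *m _); rewrite mulmxBr.
  move: (A *m xsol) (B *m ysol) (A *m x) (B *m y) => a b c d.
  by apply/matrixP => i j; rewrite !mxE; ring.
have cross c : 0 < c -> 0 <= c * dotv z z /\ 0 <= c * dotv eta eta.
  by move=> c0; rewrite !mulr_ge0 // ltW.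
have [[? ?] [[? ?] [? ?]]] := (cross Cy Cy0, (cross Cz Cz0, cross Cx Cx0)).
split; last by rewrite yE; apply: le_trans (YC eta) _; lra.
rewrite xE; apply: le_trans (dotvD_le _ _) _.
have := ZC z; have := XC eta; lra.
Qed.

End UzawaStep.

(* The order of A is n = m + k, as the shape [Sigma0, 0] of Sigma requires; the
   factor R of S = R R^t is called T. *)
Theorem theorem3p1 (R : realType) (m k : nat) (m_gt0 : (0 < m)%N)
  (A Ahat : 'M[R]_(m + k)) (B : 'M[R]_(m + k, m)) (D Shat : 'M[R]_m)
  (f : 'cV[R]_(m + k)) (g : 'cV[R]_m)
  (xsol : 'cV[R]_(m + k)) (ysol : 'cV[R]_m)
  (lam lam0 : R)
  (U T : 'M[R]_m) (V : 'M[R]_(m + k)) (sigma : 'rV[R]_m)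
  (theta : nat -> R) (x : nat -> 'cV[R]_(m + k)) (y : nat -> 'cV[R]_m)
  (G : nat -> 'M[R]_m) (c1 : R) :
  let S := schur A B D in
  let H := schur Ahat B D in
  let alpha := cond_rate (spectral_cond (invmx Ahat *m A)) in
  let beta := cond_rate (spectral_cond (invmx Shat *m H)) in
  let c0 := gen_max_eigenvalue Ahat B D in
  let delta1 := delta lam0 c0 in
  let delta2 := delta lam c0 in
  let Sigma0 := diag_mx sigma in
  let Q i := damped_mx (theta i) (G i) in
  let F i := iter_mx alpha Sigma0 U T (Q i) in
  let bound := 2 * (1 - alpha) / (1 - alpha + 2 * c1 * alpha) in
  let step_hyp i :=
    local_precond S H Shat delta1 delta2 (res_y B D g (x i.+1) (y i)) (G i) /\
    loewner_le (Sigma0^T *m U^T *m invmx (Q i) *m U *m Sigma0)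
               (c1 *: (T^T *m invmx (Q i) *m T)) in
  spd A -> spsd D -> spd S -> spd Ahat -> spd Shat ->
  A *m xsol + B *m ysol = f -> B^T *m xsol - D *m ysol = g ->
  0 < lam -> lam <= 1 -> 1 <= lam0 ->
  loewner_le (lam *: Ahat) A -> loewner_le A (lam0 *: Ahat) ->
  orthogonal_mx U -> orthogonal_mx V -> (forall j, 0 <= sigma ord0 j) ->
  B^T *m invmx (sqrtmx A) = U *m row_mx Sigma0 (0 : 'M[R]_(m, k)) *m V^T ->
  T \in unitmx -> S = T *m T^T ->
  (forall i, 0 < theta i) ->
  uzawa_iterates A B D Ahat Shat f g theta x y ->
  (forall i : nat, step_hyp i -> theta i * (1 + beta) * delta2 < bound ->
     spectral_norm (F i) < 1) /\
  ((forall i : nat, step_hyp i /\ theta i * (1 + beta) * delta2 < bound) ->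
     (* the bound on the norms is uniform for, e.g., a constant theta *)
     ((exists2 t : R, 0 < t & forall i : nat, t <= theta i) ->
      (exists2 q : R, q < bound &
         forall i : nat, theta i * (1 + beta) * delta2 <= q) ->
      exists2 rho : R, rho < 1 & forall i : nat, spectral_norm (F i) <= rho) /\
     ((exists2 rho : R, rho < 1 &
         forall i : nat, spectral_norm (F i) <= rho) ->
      x @ \oo --> xsol /\ y @ \oo --> ysol)).
Proof.
move=> S H alpha beta c0 delta1 delta2 Sigma0 Q F bound step_hyp.
move=> pA pD pS pAhat pShat xsolE ysolE lam_gt0 lam_le1 lam0_ge1 _ _ _ orthV _ svd.
move=> uT ST theta_gt0 iter.
have n_gt0 : (0 < m + k)%N by rewrite addn_gt0 m_gt0.
have pH : spd H by apply: schur_spd pAhat pD pS.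
have alpha01 := cond_rate_ge0_lt1 A Ahat n_gt0 pA pAhat.
have beta01 := cond_rate_ge0_lt1 H Shat m_gt0 pH pShat.
rewrite -/alpha in alpha01; rewrite -/beta in beta01.
have [[alpha0 alpha1] [beta0 beta1]] := (andP alpha01, andP beta01).
have c0_ge0 := gen_max_eigenvalue_ge0 Ahat B D pAhat pD.
have d1_gt0 : 0 < delta1 by apply: delta_gt0; [lra|].
have d2_gt0 : 0 < delta2 by exact: delta_gt0.
have form_bounds i : step_hyp i -> spsd (invmx (Q i)) /\ forall v,
    theta i * (1 - beta) * delta1 * dotv v v <=
    dotv (T^T *m invmx (Q i) *m T *m v) v <= theta i * (1 + beta) * delta2 * dotv v v.
  move=> [loc _].
  exact: damped_form_bounds m_gt0 pS pH pShat ST d1_gt0 d2_gt0 (theta_gt0 i) loc.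
have c1_ge0 i : step_hyp i -> 0 <= c1.
  move=> st; have [pP Pb] := form_bounds i st; have [_ NM] := st.
  apply: loewner_scale_ge0 m_gt0 _ _ NM => v.
    rewrite -!mulmxA (dotv_mull Sigma0^T) (dotv_mull U^T) !trmxK.
    exact: pP.2.
  move=> v0; have /andP[+ _] := Pb v; apply: lt_le_trans.
  by rewrite mulr_gt0 ?dotv_gt0 // !mulr_gt0 // subr_gt0.
(* The index set [J] covers the claim for a single step, with [J] a singleton, and the uniform
   claim, with [J] all of [nat]. *)
have norm_lt1 (J : nat -> Prop) (t q : R) : 0 < t -> q < bound -> (exists i, J i) ->
    (forall i, J i -> [/\ step_hyp i, t <= theta i &
      theta i * (1 + beta) * delta2 <= q]) ->
    exists2 rho : R, rho < 1 & forall i, J i -> spectral_norm (F i) <= rho.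
  move=> t0 q_lt [j Jj] Jh; have [stj _ qj] := Jh j Jj.
  have mu0 : 0 < t * (1 - beta) * delta1 by rewrite !mulr_gt0 // subr_gt0.
  have q0 : 0 < q.
    by apply: lt_le_trans qj; rewrite !mulr_gt0 // ltr_wpDr.
  have [rho rho1 Frho] :=
    iter_mx_norm (m := m) _ _ _ _ alpha01 (c1_ge0 j stj) mu0 q0 q_lt.
  exists rho => // i Ji; have [st ti qi] := Jh i Ji.
  have [pP Pb] := form_bounds i st; have [_ NM] := st.
  apply: Frho => // v; have /andP[l u] := Pb v; apply/andP; split.
    apply: le_trans l; rewrite ler_wpM2r ?dotv_ge0 // ler_pM2r // ler_pM2r //.
    by rewrite subr_gt0.
  by apply: le_trans u _; rewrite ler_wpM2r ?dotv_ge0.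
split=> [i st lt_bound|hyp].
  have [||rho rho1 Frho] := norm_lt1 (eq i) (theta i) _ (theta_gt0 i) lt_bound.
  - by exists i.
  - by move=> _ <-; split.
  - by apply: le_lt_trans rho1; apply: Frho.
split=> [[t t0 t_le] [q q_lt q_ge]|[rho rho1 Frho]].
  have [||rho rho1 Frho] := norm_lt1 (fun=> True) t q t0 q_lt.
  - by exists 0%N.
  - by move=> i _; split=> //; have [] := hyp i.
  - by exists rho => // i; apply: Frho.
have c10 := c1_ge0 0%N (hyp 0%N).1.
have bound0 : 0 < bound.
  rewrite /bound divr_gt0 ?mulr_gt0 ?subr_gt0 //.
  by have := mulr_ge0 c10 alpha0; lra.
have [Cs Cs0 solC] := sol_errors A B f xsol ysol T V pA xsolE orthV uT.
have [Cz Cz0 stepC] := zstep_le (k := k) Sigma0 U T bound uT bound0.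
(* The block governed by F contracts by [rho], the other [k] coordinates by [alpha]. *)
pose r := Num.max rho alpha.
have [rho_r alpha_r] : rho <= r /\ alpha <= r by rewrite !le_max !lexx orbT.
have r_lt1 : r < 1 by rewrite gt_max rho1.
have r_ge0 : 0 <= r by apply: le_trans alpha_r.
pose z i := zcoord A B f V (x i) (y i); pose eta i := etacoord ysol T (y i).
pose e i := alpha * dotv (z i) (z i) + dotv (eta i) (eta i).
have e_step i : e i.+1 <= r ^+ 2 * e i /\
    dotv (z i.+1) (z i.+1) + dotv (eta i.+1) (eta i.+1) <= (Cz + 1) * e i.
  have [st lt_bound] := hyp i; have [pP Pb] := form_bounds i st.
  have [xE yE] := iter i; have [[_ Gg _] _] := st.
  (* The interpolation property of [G i] at the residual replaces the scaled preconditioner by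
     Q_i^-1. *)
  have yE' : y i.+1 = y i + invmx (Q i) *m res_y B D g (x i.+1) (y i).
    by rewrite yE invmx_damped -scalemxAl Gg scalerA.
  have [zh [zh_le zE etaE]] := uzawa_step_coord A Ahat B D f g xsol ysol U T V Sigma0
    m_gt0 pA pAhat xsolE ysolE orthV svd ST _ _ _ _ _ xE yE'.
  have e_le := step_contraction Sigma0 U T (Q i) alpha rho r (z i) zh (eta i)
    alpha0 r_ge0 alpha_r rho_r (Frho i) zh_le.
  rewrite /= -zE -etaE in e_le; split=> //.
  have Pbound v : dotv (T^T *m invmx (Q i) *m T *m v) v <= bound * dotv v v.
    have /andP[_ u] := Pb v; apply: le_trans u _.
    by rewrite ler_wpM2r ?dotv_ge0 // ltW.
  have z_le := stepC _ pP Pbound zh (eta i); rewrite -zE in z_le.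
  (* Since alpha^2 <= alpha, the weighted energy controls [zh] even for [alpha = 0]; [zstep_le] then
     controls the next z without weight. *)
  have zh_e : dotv zh zh + dotv (eta i) (eta i) <= e i.
    rewrite lerD2r (le_trans zh_le) // ler_wpM2r ?dotv_ge0 // expr2.
    by rewrite ler_piMl // ltW.
  have e0 : 0 <= e i by rewrite addr_ge0 ?dotv_ge0 // mulr_ge0 ?dotv_ge0.
  have re_le : r ^+ 2 * e i <= e i by rewrite ler_piMl // exprn_ile1 // ltW.
  have az_ge0 : 0 <= alpha * dotv (z i.+1) (z i.+1) by rewrite mulr_ge0 ?dotv_ge0.
  rewrite mulrDl mul1r; apply: lerD.
    by apply: le_trans z_le _; rewrite ler_pM2l.
  by apply: le_trans re_le; apply: le_trans e_le; rewrite lerDr.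
have e_geo i : e i <= e 0%N * (r ^+ 2) ^+ i.
  elim: i => [|i IHi]; first by rewrite expr0 mulr1.
  apply: le_trans (e_step i).1 _.
  by rewrite [_ ^+ i.+1]exprS mulrCA ler_wpM2l ?sqr_ge0.
have r2 : 0 <= r ^+ 2 < 1 by rewrite sqr_ge0 exprn_ilt1.
have err i : Cs * (dotv (z i.+1) (z i.+1) + dotv (eta i.+1) (eta i.+1)) <=
    Cs * (Cz + 1) * e 0%N * (r ^+ 2) ^+ i.
  rewrite -!mulrA ler_pM2l //; apply: le_trans (e_step i).2 _.
  by rewrite ler_pM2l // ltr_wpDr.
split; apply: (cvg_geometric_dotv _ _ (Cs * (Cz + 1) * e 0%N) (r ^+ 2)) => // i.
  exact: le_trans (solC (x i.+1) (y i.+1)).1 (err i).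
exact: le_trans (solC (x i.+1) (y i.+1)).2 (err i).
Qed.
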